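(* Let $p$ be an odd prime and let $G$ be a graph on $2p$ vertices such that $p^2$ divides $|\mathrm{Aut}(G)|$, or equivalently such that $p$ does not divide $|[G]|$. Then $G$ is isomorphic to a graph of the form $G_1\cup G_2$ or to a graph of the form $G_1+G_2$, where $G_1$ and $G_2$ are graphs on $p$ vertices (with disjoint vertex sets), each of which is either $\overline{K}_p$ or isomorphic to some graph $C(s_1,s_2,\ldots,s_l)$ with $l\geq 1$ and $s_1,\ldots,s_l$ distinct elements of $\{1,\ldots,(p-1)/2\}$. The graphs $G_1$ and $G_2$ are allowed to be isomorphic.
   Context: Graphs are finite and simple. For a graph $G$ on $n$ vertices (with a fixed vertex set of size $n$), $[G]$ denotes its isomorphism class, i.e. the set of all graphs on that same vertex set isomorphic to $G$; thus $|[G]|=n!/|\mathrm{Aut}(G)|$. $\overline{K}_p$ is the graph on $p$ vertices with no edges. For graphs $G_1,G_2$ with disjoint vertex sets, $G_1\cup G_2$ has vertex set $V(G_1)\cup V(G_2)$ and edge set $E(G_1)\cup E(G_2)$; the join $G_1+G_2$ has vertex set $V(G_1)\cup V(G_2)$ and edge set $E(G_1)\cup E(G_2)\cup\{\{v_1,v_2\}: v_1\in V(G_1), v_2\in V(G_2)\}$. For $s\in\{1,2,\ldots,(p-1)/2\}$, $C(s)$ is the cycle graph of length $p$ with vertex set the finite field $\mathbb{F}_p=\{0,1,\ldots,p-1\}$ and edges $\{0,s\},\{s,2s\},\{2s,3s\},\ldots,\{(p-1)s,0\}$ (arithmetic in $\mathbb{F}_p$). For distinct $s_1,\ldots,s_l\in\{1,\ldots,(p-1)/2\}$,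 $C(s_1,\ldots,s_l)$ is the graph with vertex set $\mathbb{F}_p$ whose edge set is the union of the edge sets of $C(s_1),\ldots,C(s_l)$. *)

(* Defs.v *)
From HB Require Import structures.
From mathcomp Require Import all_boot all_order all_algebra all_fingroup.

Set Implicit Arguments.
Unset Strict Implicit.
Unset Printing Implicit Defensive.

(* Using a subtype of {set {set V}} makes the graphs on V a finType, so that
   isomorphism classes are finite sets of graphs. *)
Record sgraph (V : finType) := SGraph {
  edges : {set {set V}};
  _ : [forall e in edges, #|e| == 2]
}.

HB.instance Definition _ (V : finType) := [isSub for @edges V].
HB.instance Definition _ (V : finType) := [Finite of sgraph V by <:].

Lemma sgraph_of_subproof (V : finType) (E : {set {set V}}) :
  [forall e in [set e in E | #|e| == 2], #|e| == 2].
Proof. by apply/forall_inP => e; rewrite inE => /andP[]. Qed.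

(* The elements of E that are not pairs of vertices are discarded; this never
   happens in the uses below, for p prime and steps in 1..(p-1)/2: see
   edges_gunion, edges_gjoin and edges_circulant. *)
Definition sgraph_of (V : finType) (E : {set {set V}}) : sgraph V :=
  SGraph (sgraph_of_subproof E).

Lemma edges_sgraph_of (V : finType) (E : {set {set V}}) :
  {in E, forall e : {set _}, #|e| = 2} -> edges (sgraph_of E) = E.
Proof.
move=> E2; apply/setP=> e; rewrite inE.
by case: (boolP (e \in E)) => //= /E2 ->.
Qed.

Lemma card_edge (V : finType) (G : sgraph V) : {in edges G, forall e : {set _}, #|e| = 2}.
Proof. by case: G => E /= /forall_inP E2 e /E2/eqP. Qed.

Definition adj (V : finType) (G : sgraph V) : rel V :=
  fun x y => [set x; y] \in edges G.

Definition giso (V W : finType) (G : sgraph V) (H : sgraph W) : bool :=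
  [exists f : {ffun V -> W},
     [&& injectiveb f, [forall y, y \in codom f]
       & [forall x, forall y, adj H (f x) (f y) == adj G x y]]].

Lemma gisoP (V W : finType) (G : sgraph V) (H : sgraph W) :
  reflect (exists2 f : V -> W, bijective f &
             forall x y, adj H (f x) (f y) = adj G x y)
          (giso G H).
Proof.
apply: (iffP existsP) => [[f /and3P[/injectiveP fI /forallP fS /forallP fA]]|].
  exists f; last by move=> x y; have /forallP/(_ y)/eqP := fA x.
  exists (fun y => iinv (fS y)) => [x|y]; last exact: f_iinv.
  by apply: fI; rewrite f_iinv.
case=> f [g fK gK] fA; exists (finfun f); apply/and3P; split.
- by apply/injectiveP=> x y; rewrite !ffunE; apply: (can_inj fK).
- by apply/forallP=> y; apply/codomP; exists (g y); rewrite ffunE gK.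
- by apply/forallP=> x; apply/forallP=> y; rewrite !ffunE fA.
Qed.

Definition iso_class (V : finType) (G : sgraph V) : {set sgraph V} :=
  [set H : sgraph V | giso G H].

Definition Aut_graph (V : finType) (G : sgraph V) : {set {perm V}} :=
  [set s : {perm V} | [forall x, forall y, adj G (s x) (s y) == adj G x y]].

Definition edgeless (V : finType) : sgraph V := sgraph_of set0.

(* Disjointness of the vertex sets is implemented by the sum type. *)
Definition gunion_edges (V1 V2 : finType) (G1 : sgraph V1) (G2 : sgraph V2) :
    {set {set V1 + V2}} :=
  [set inl @: (e : {set V1}) | e in edges G1]
    :|: [set inr @: (e : {set V2}) | e in edges G2].

Definition gunion (V1 V2 : finType) (G1 : sgraph V1) (G2 : sgraph V2) :
    sgraph (V1 + V2)%type :=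
  sgraph_of (gunion_edges G1 G2).

Definition gjoin_edges (V1 V2 : finType) (G1 : sgraph V1) (G2 : sgraph V2) :
    {set {set V1 + V2}} :=
  gunion_edges G1 G2 :|: [set [set inl v1; inr v2] | v1 : V1, v2 : V2].

Definition gjoin (V1 V2 : finType) (G1 : sgraph V1) (G2 : sgraph V2) :
    sgraph (V1 + V2)%type :=
  sgraph_of (gjoin_edges G1 G2).

(* The pair for i = p - 1 is {(p-1)s, 0}, as p%:R = 0 in 'F_p. *)
Definition cycle_edges (p s : nat) : {set {set 'F_p}} :=
  [set [set (i * s)%:R%R; (i.+1 * s)%:R%R] | i : 'I_p].

(* C(s_1, ..., s_l) with ss = [:: s_1; ...; s_l]. *)
Definition circulant_edges (p : nat) (ss : seq nat) : {set {set 'F_p}} :=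
  \bigcup_(s <- ss) cycle_edges p s.

Definition circulant (p : nat) (ss : seq nat) : sgraph 'F_p :=
  sgraph_of (circulant_edges p ss).

Definition circulant_steps (p : nat) (ss : seq nat) : bool :=
  uniq ss && all (fun s => 1 <= s <= p.-1 %/ 2) ss.

Definition edgeless_or_circulant (p : nat) (V : finType) (G : sgraph V) : Prop :=
  G = edgeless V \/
  exists ss : seq nat,
    [/\ 1 <= size ss, circulant_steps p ss & giso G (circulant p ss)].

Lemma edges_edgeless (V : finType) : edges (edgeless V) = set0.
Proof. by apply: edges_sgraph_of => e; rewrite inE. Qed.

Lemma card_gunion_edges (V1 V2 : finType) (G1 : sgraph V1) (G2 : sgraph V2) :
  {in gunion_edges G1 G2, forall e : {set _}, #|e| = 2}.
Proof.
move=> e; rewrite inE => /orP[] /imsetP[d /card_edge <- ->]; apply: card_imset.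
- exact: inl_inj.
- exact: inr_inj.
Qed.

Lemma edges_gunion (V1 V2 : finType) (G1 : sgraph V1) (G2 : sgraph V2) :
  edges (gunion G1 G2) = gunion_edges G1 G2.
Proof. exact/edges_sgraph_of/card_gunion_edges. Qed.

Lemma edges_gjoin (V1 V2 : finType) (G1 : sgraph V1) (G2 : sgraph V2) :
  edges (gjoin G1 G2) = gjoin_edges G1 G2.
Proof.
apply: edges_sgraph_of => e; rewrite inE => /orP[/card_gunion_edges //|].
by case/imset2P=> v1 v2 _ _ ->; rewrite cards2.
Qed.

Lemma edges_circulant (p : nat) (ss : seq nat) :
  prime p -> circulant_steps p ss ->
  edges (circulant p ss) = circulant_edges p ss.
Proof.
move=> p_pr /andP[_ /allP ssP]; apply: edges_sgraph_of => e.
rewrite /circulant_edges; elim: ss ssP => [|s ss IHss] ssP.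
  by rewrite big_nil inE.
rewrite big_cons inE => /orP[/imsetP[i _ ->]|]; last first.
  by apply: IHss => t t_ss; apply: ssP; rewrite inE t_ss orbT.
have /andP[s_gt0 s_le] := ssP s (mem_head _ _).
rewrite cards2 mulSn GRing.natrD eq_sym -GRing.subr_eq0 GRing.addrK.
rewrite -(GRing.dvdn_pcharf (pchar_Fp p_pr)) gtnNdvd //.
by rewrite (leq_ltn_trans s_le) // (leq_ltn_trans (leq_div _ _)) //
           prednK ?prime_gt0.
Qed.

(* Main.v *)
(* The Sylow p-subgroups of Sym V have order p ^ 2 = p-part of (2p)!, so when
   p ^ 2 divides the order of Aut G, some Sylow subgroup of Aut G is one of
   Sym V. By conjugacy it contains two disjoint p-cycles; using these as
   coordinates 'F_p + 'F_p on V, adjacency is invariant under each of the two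
   translations separately. Hence adjacency across the two halves is constant,
   and inside each half it only depends on the difference of the vertices. *)
Require Import Defs.
From HB Require Import structures.
From mathcomp Require Import all_boot all_order all_algebra all_fingroup.
From mathcomp Require Import all_solvable zify.

Set Implicit Arguments.
Unset Strict Implicit.
Unset Printing Implicit Defensive.

(** * Two-element sets and bijections of finite types *)

Lemma eq_set2 (T : finType) (a b c d : T) :
  ([set a; b] == [set c; d]) =
  (a == c) && (b == d) || (a == d) && (b == c).
Proof.
apply/eqP/orP => [eq_ab|]; last first.
  by case=> /andP[/eqP-> /eqP->] //; rewrite setUC.
have: a \in [set c; d] by rewrite -eq_ab set21.
have: b \in [set c; d] by rewrite -eq_ab set22.
have: c \in [set a; b] by rewrite eq_ab set21.
have: d \in [set a; b] by rewrite eq_ab set22.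
rewrite !inE !(eq_sym c) !(eq_sym d).
by case: (a == c) (b == c) (a == d) (b == d) => [] [] [] []; auto.
Qed.

Lemma imset_set2 (S T : finType) (f : S -> T) (x y : S) :
  f @: [set x; y] = [set f x; f y].
Proof. by rewrite imsetU1 imset_set1. Qed.

Lemma eq_card_bij (S T : finType) :
  #|S| = #|T| -> exists f : S -> T, bijective f.
Proof.
move=> eqST; exists (enum_val \o cast_ord eqST \o enum_rank).
apply: bij_comp (enum_rank_bij S); apply: bij_comp (enum_val_bij T) _.
by exists (cast_ord (esym eqST)); [apply: cast_ordK | apply: cast_ordKV].
Qed.

Definition sum_map (A B C D : Type) (f : A -> B) (g : C -> D) (u : A + C) : B + D :=
  match u with inl x => inl (f x) | inr y => inr (g y) end.

(** * Adjacency, isomorphism, induced graphs, unions and joins *)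

Section Graphs.
Variables U V W : finType.
Implicit Types (G : sgraph V) (H : sgraph W).

Lemma adj_sym G x y : adj G x y = adj G y x.
Proof. by rewrite /adj setUC. Qed.

Lemma adj_irr G x : adj G x x = false.
Proof. by apply/negP => /card_edge; rewrite cards2 eqxx. Qed.

Lemma edgeP G e : reflect (exists x y, e = [set x; y] /\ adj G x y) (e \in edges G).
Proof.
apply: (iffP idP) => [Ge|[x [y [-> //]]]].
have /eqP/cards2P[x [y [_ e_xy]]] := card_edge Ge.
by exists x, y; rewrite /adj -e_xy.
Qed.

Lemma giso_sym G H : giso G H -> giso H G.
Proof.
case/gisoP=> f [g fK gK] fA; apply/gisoP; exists g; first by exists f.
by move=> x y; rewrite -fA !gK.
Qed.

Lemma giso_trans (F : sgraph U) G H : giso F G -> giso G H -> giso F H.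
Proof.
case/gisoP=> f bij_f fA /gisoP[g bij_g gA]; apply/gisoP.
by exists (g \o f) => [|x y]; [apply: bij_comp | rewrite /= gA fA].
Qed.

(** The pullback of [H] along [f], used only for injective [f]: a set mapped onto an edge is then a
    pair, so [sgraph_of] discards nothing. *)
Definition induced_graph (f : V -> W) H : sgraph V :=
  sgraph_of [set e : {set V} | f @: e \in edges H].

Lemma adj_induced (f : V -> W) H x y :
  injective f -> adj (induced_graph f H) x y = adj H (f x) (f y).
Proof.
move=> f_inj; rewrite /adj edges_sgraph_of ?inE ?imset_set2 // => e.
by rewrite inE => /card_edge; rewrite card_imset.
Qed.

Lemma giso_induced (f : V -> W) H : bijective f -> giso (induced_graph f H) H.
Proof.
move=> bij_f; apply/gisoP; exists f => // x y.
by rewrite adj_induced //; apply: bij_inj.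
Qed.

Lemma edgelessP G : reflect (forall x y, adj G x y = false) (G == edgeless V).
Proof.
apply: (iffP eqP) => [-> x y|G0]; first by rewrite /adj edges_edgeless inE.
apply: (@val_inj _ _ (sgraph V)); transitivity (edges (edgeless V)) => //.
rewrite edges_edgeless; apply/eqP; rewrite -subset0.
by apply/subsetP => e /edgeP[x [y [_]]]; rewrite G0.
Qed.

Lemma adj_gunion (G : sgraph V) (H : sgraph W) (u v : V + W) :
  adj (gunion G H) u v = match u, v with
    | inl x, inl y => adj G x y
    | inr x, inr y => adj H x y
    | _, _ => false
    end.
Proof.
rewrite /adj edges_gunion /gunion_edges inE.
case: u v => [x|x] [y|y].
- rewrite -imset_set2 mem_imset; last exact/imset_inj/inl_inj.
  apply/orb_idr => /imsetP[e _] /setP/(_ (inl x)).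
  by rewrite imset_f ?set21 // => /esym/imsetP[].
- apply/negbTE/norP; split; apply/negP => /imsetP[e _] /setP.
    by move/(_ (inr y)); rewrite set22 => /esym/imsetP[].
  by move/(_ (inl x)); rewrite set21 => /esym/imsetP[].
- apply/negbTE/norP; split; apply/negP => /imsetP[e _] /setP.
    by move/(_ (inr x)); rewrite set21 => /esym/imsetP[].
  by move/(_ (inl y)); rewrite set22 => /esym/imsetP[].
- rewrite -imset_set2 orbC mem_imset; last exact/imset_inj/inr_inj.
  apply/orb_idr => /imsetP[e _] /setP/(_ (inr x)).
  by rewrite imset_f ?set21 // => /esym/imsetP[].
Qed.

Lemma adj_gjoin (G : sgraph V) (H : sgraph W) (u v : V + W) :
  adj (gjoin G H) u v = match u, v with
    | inl x, inl y => adj G x y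
    | inr x, inr y => adj H x y
    | _, _ => true
    end.
Proof.
have := adj_gunion G H u v.
rewrite /adj edges_gunion edges_gjoin /gjoin_edges [in X in _ -> X]inE => ->.
case: u v => [x|x] [y|y].
- apply/orb_idr => /imset2P[v w _ _] /eqP; rewrite eq_set2.
  by case/orP => /andP[]; rewrite // eq_sym.
- by apply/imset2P; exists x y.
- by rewrite setUC; apply/imset2P; exists y x.
- apply/orb_idr => /imset2P[v w _ _] /eqP; rewrite eq_set2.
  by case/orP => /andP[]; rewrite // eq_sym.
Qed.

End Graphs.

(** * Counting an isomorphism class *)

Section Counting.
Local Open Scope group_scope.
Variable V : finType.
Implicit Types G H : sgraph V.

(** Permutations act on sets of vertices, and through these on edge sets; automorphisms become a
    stabiliser and isomorphism classes become orbits. *)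
Local Notation edge_act := (('P^* )^* )%act.

Lemma perm_adjP G H (s : {perm V}) :
  reflect (forall x y, adj H (s x) (s y) = adj G x y)
          (edge_act (edges G) s == edges H).
Proof.
have act2 x y : 'P^*%act [set x; y] s = [set s x; s y].
  by rewrite /= /setact imset_set2.
have -> : edge_act (edges G) s = ('P^*%act)^~ s @: edges G by [].
apply: (iffP eqP) => [eqH x y|sA].
  by rewrite /adj -eqH -act2 (mem_imset _ _ (act_inj _ s)).
apply/setP => e; apply/imsetP/edgeP => [[d /edgeP[x [y [-> Gxy]]] ->]|].
  by exists (s x), (s y); rewrite act2 sA.
case=> x [y [-> Hxy]]; exists [set s^-1 x; s^-1 y]; last by rewrite act2 !permKV.
by change (adj G (s^-1 x) (s^-1 y)); rewrite -sA !permKV.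
Qed.

Lemma Aut_graphE G : Aut_graph G = 'C[edges G | edge_act].
Proof.
apply/setP => s; rewrite inE; apply/idP/astab1P => [sA|/eqP/perm_adjP sA].
  by apply/eqP/perm_adjP => x y; have /forallP/(_ y)/eqP := forallP sA x.
by apply/forallP => x; apply/forallP => y; rewrite sA.
Qed.

Lemma iso_class_orbit G :
  @edges V @: iso_class G = orbit edge_act [set: {perm V}] (edges G).
Proof.
apply/setP => E; apply/imsetP/orbitP.
  case=> H; rewrite inE => /gisoP[f /bij_inj f_inj fA] ->.
  exists (perm f_inj); rewrite ?inE //.
  by apply/eqP/perm_adjP => x y; rewrite !permE.
case=> s _ <-; set E' := edge_act _ _.
(* The action preserves cardinality, so the translate is again a set of pairs, hence the edge set of
   a graph. *)
have E'2 : {in E', forall e : {set V}, #|e| = 2}.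
  move=> e /imsetP[d /card_edge <- ->]; rewrite /= /setact card_imset //.
  exact: act_inj.
exists (sgraph_of E'); rewrite ?edges_sgraph_of // inE; apply/gisoP.
exists s; first by exists s^-1; [apply: permK | apply: permKV].
by apply/perm_adjP; rewrite edges_sgraph_of.
Qed.

(** Orbit-stabiliser, since a graph is determined by its edge set. *)
Lemma card_iso_class G : (#|iso_class G| * #|Aut_graph G| = #|V|`!)%N.
Proof.
rewrite -(card_imset _ (@val_inj _ _ (sgraph V))) iso_class_orbit Aut_graphE.
by rewrite -['C[_ | _]]setTI card_orbit_stab card_Sym.
Qed.

End Counting.

(** * Sylow p-subgroups of the symmetric group on 2p points *)

Lemma logn_fact_double p : prime p -> odd p -> logn p (2 * p)`! = 2.
Proof.
move=> p_pr p_odd; have p_gt2 := odd_prime_gt2 p_odd p_pr.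
(* In Legendre's sum the term of exponent 1 is 2; the others vanish because p > 2 gives 2p < p ^
   2. *)
rewrite logn_fact // big_ltn; last by lia.
rewrite expn1 mulnK ?prime_gt0 // big_nat big1 // => k /andP[k_gt1 _].
apply: divn_small; apply: (@leq_trans (p ^ 2)); last by rewrite leq_pexp2l ?prime_gt0.
by rewrite ltn_mul2r prime_gt0.
Qed.

(* A subgroup of order divisible by p ^ 2 contains a Sylow subgroup of Sym V. *)
Lemma conj_commuting_p_elts (p : nat) (V : finType) (A : {group {perm V}})
    (c d : {perm V}) :
  prime p -> odd p -> #|V| = 2 * p -> p ^ 2 %| #|A| ->
  (c ^+ p = 1 -> d ^+ p = 1 -> commute c d ->
   exists x : {perm V}, c ^ x \in A /\ d ^ x \in A)%g.
Proof.
move=> p_pr p_odd cardV pA c_p d_p cd.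
have [P sylP] := Sylow_exists p A.
have sylPT : (p.-Sylow([set: {perm V}]) P)%g.
  have [sPA _] := andP sylP; rewrite pHallE subsetT (card_Hall sylP) /=.
  rewrite !p_part eqn_exp2l ?prime_gt1 // card_Sym cardV logn_fact_double //.
  (* Squeeze: [logn p #|A|] is at least 2 by hypothesis, and at most 2 because the order of [A]
     divides (2p)!. *)
  rewrite eqn_leq -[X in _ && (X <= _)](pfactorK 2 p_pr) dvdn_leq_log // andbT.
  rewrite -(logn_fact_double p_pr p_odd) -cardV -card_Sym.
  by rewrite dvdn_leq_log ?cardG_gt0 ?cardSg ?subsetT.
have p_elt (e : {perm V}) : (e ^+ p = 1 -> p.-group <[e]>)%g.
  move=> /eqP; rewrite -order_dvdn => e_p.
  exact: pnat_dvd e_p (pnat_id p_pr).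
(* As [c] and [d] commute, they generate a p-group, which Sylow's theorem conjugates into [P]. *)
have pQ : (p.-group (<[c]> <*> <[d]>))%g.
  by rewrite cent_joinEr ?cents_cycle // pgroupM !p_elt.
have [x _ sQP] := Sylow_Jsub sylPT (subsetT _) pQ.
have inA e : (e \in <[c]> <*> <[d]> -> e ^ x \in A)%g.
  move=> Qe; apply: (subsetP (pHall_sub sylP)); apply: (subsetP sQP).
  by rewrite memJ_conjg.
exists x; split; apply: inA.
  by rewrite mem_gen // inE cycle_id.
by rewrite mem_gen // inE cycle_id orbT.
Qed.

(** * Circulant graphs on the prime field *)

Section PrimeField.
Local Open Scope ring_scope.
Import GRing.Theory.
Variable p : nat.
Hypotheses (p_pr : prime p) (p_odd : odd p).
Implicit Types x y : 'F_p.

(** The element 1 generates the additive group, so induction on the natural number representing [x]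
    reaches every point. *)
Lemma Fp_shift_const (T : Type) (F : 'F_p -> T) :
  (forall x, F (x + 1) = F x) -> forall x, F x = F 0.
Proof.
move=> F1 x; rewrite -(natr_Zp x); elim: (x : nat) => // n IHn.
by rewrite -addn1 natrD F1.
Qed.

Lemma Fp_ltn x : (x < p)%N.
Proof. by rewrite -{2}(Fp_cast p_pr). Qed.

Lemma Fp_nat_neq0 s : (0 < s < p)%N -> s%:R != 0 :> 'F_p.
Proof.
case/andP=> s_gt0 s_lt; rewrite -(dvdn_pcharf (pchar_Fp p_pr)).
by rewrite gtnNdvd.
Qed.

Lemma Fp_sign_nat x : x != 0 ->
  exists2 s : nat, (1 <= s <= p.-1 %/ 2)%N & x = s%:R \/ x = - s%:R.
Proof.
move=> x0; have x_lt := Fp_ltn x.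
have x_gt0 : (0 < x)%N by rewrite lt0n.
have [x_le|x_gt] := leqP x (p.-1 %/ 2).
  by exists x; [rewrite x_gt0 | left; rewrite natr_Zp].
(* The representative of -x; it falls in the lower half because p is odd. *)
exists (p - x)%N; first by lia.
by right; rewrite natrB ?(ltnW x_lt) // pchar_Fp_0 // sub0r opprK natr_Zp.
Qed.

Lemma adj_circulant ss x y : circulant_steps p ss ->
  adj (circulant p ss) x y =
  has (fun s => (y == x + s%:R) || (x == y + s%:R)) ss.
Proof.
move=> ssP; rewrite /adj edges_circulant //; case/andP: ssP => _.
rewrite /circulant_edges; elim: ss => [|s ss IHss] /=.
  by rewrite big_nil inE.
case/andP=> s_range /IHss {}IHss; rewrite big_cons inE {}IHss; congr (_ || _).
have s0 : s%:R != 0 :> 'F_p by apply: Fp_nat_neq0; lia.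
have cycleP z : [set z; z + s%:R] \in cycle_edges p s.
  (* As [s] is invertible, [z] is the multiple t * s with t = z / s, and t is the index of the edge
     in the cycle. *)
  rewrite -[z](divfK s0); move: (z / _) => t.
  apply/imsetP; exists (Ordinal (Fp_ltn t)) => //=.
  by rewrite mulSn natrD natrM natr_Zp addrC.
apply/imsetP/orP => [[i _ /eqP]|[] /eqP->].
- rewrite eq_set2 mulSn natrD addrC.
  by case/orP=> /andP[/eqP-> /eqP->]; rewrite eqxx; [left | right].
- exact/imsetP.
- by rewrite setUC; apply/imsetP.
Qed.

Lemma edgeless_or_circulant_giso (U V : finType) (G : sgraph U) (H : sgraph V) :
  giso G H -> edgeless_or_circulant p H -> edgeless_or_circulant p G.
Proof.
move=> isoGH [H0|[ss [ss_gt0 ssP isoH]]]; last first.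
  by right; exists ss; split=> //; apply: giso_trans isoGH isoH.
left; apply/eqP/edgelessP => x y; have [f _ <-] := gisoP _ _ isoGH.
by move: (f x) (f y); apply/edgelessP; rewrite H0.
Qed.

(** Adjacency depends only on the difference of the vertices and, by symmetry, only up to sign. Up
    to sign every nonzero difference is a step in 1..(p-1)/2, so the neighbours of 0 among these
    steps determine [H]. *)
Lemma shift_invariant_circulant (H : sgraph 'F_p) :
  (forall x y, adj H (x + 1) (y + 1) = adj H x y) -> edgeless_or_circulant p H.
Proof.
move=> H1; have HD x y z : adj H (x + z) (y + z) = adj H x y.
  have := Fp_shift_const (F := fun z => adj H (x + z) (y + z)).
  by move=> ->; [rewrite !addr0 | move=> t; rewrite !addrA H1].
pose ss := [seq s <- iota 1 (p.-1 %/ 2) | adj H 0 s%:R].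
have ssP : circulant_steps p ss.
  rewrite /circulant_steps filter_uniq ?iota_uniq //=; apply/allP => s.
  by rewrite mem_filter mem_iota; lia.
have adjH x y : adj H x y = adj (circulant p ss) x y.
  rewrite adj_circulant //; apply/idP/hasP => [Hxy|[s]].
    have : y - x != 0.
      by apply: contraTneq Hxy => /subr0_eq->; rewrite adj_irr.
    case/Fp_sign_nat => s s_range xy_s.
    have s_y : (y == x + s%:R) || (x == y + s%:R).
      case: xy_s => def_s; apply/orP; [left | right]; apply/eqP.
        by rewrite -def_s addrC subrK.
      by rewrite -[s%:R]opprK -def_s opprB addrC subrK.
    exists s => //; rewrite mem_filter mem_iota; apply/andP; split; last by lia.
    case/orP: s_y Hxy => /eqP->; rewrite addrC.
      by rewrite -{1}[x]add0r HD.
    by rewrite adj_sym -{1}[y]add0r HD.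
  rewrite mem_filter => /andP[Hs _] /orP[]/eqP->.
    by rewrite addrC -{1}[x]add0r HD.
  by rewrite adj_sym addrC -{1}[y]add0r HD.
(* With no step at all there is no edge: this is the edgeless alternative, as the circulant one
   requires a step. *)
have [ss0|ss_gt0] := posnP (size ss); last first.
  by right; exists ss; split=> //; apply/gisoP; exists id => //; exists id.
left; apply/eqP/edgelessP => x y; rewrite adjH adj_circulant //.
by rewrite (size0nil ss0).
Qed.

(** * Coordinates in which the graph is invariant under two independent translations *)

Let shift1 : 'F_p + 'F_p -> 'F_p + 'F_p := sum_map (fun x => x + 1) id.
Let shift2 : 'F_p + 'F_p -> 'F_p + 'F_p := sum_map id (fun x => x + 1).

Lemma bi_shift_coordinates (V : finType) (G : sgraph V) :
  #|V| = (2 * p)%N -> (p ^ 2 %| #|Aut_graph G|)%N ->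
  exists h : 'F_p + 'F_p -> V,
    [/\ bijective h,
        forall u v, adj G (h (shift1 u)) (h (shift1 v)) = adj G (h u) (h v)
      & forall u v, adj G (h (shift2 u)) (h (shift2 v)) = adj G (h u) (h v)].
Proof.
move=> cardV pG.
(* Arbitrary coordinates, to be corrected by a permutation of [V] below. *)
have [h0 [k h0K kK]] : exists h0 : 'F_p + 'F_p -> V, bijective h0.
  by apply: eq_card_bij; rewrite card_sum card_Fp // cardV mul2n addnn.
have iter1 n w : iter n shift1 w = sum_map (fun x => x + n%:R) id w.
  elim: n => [|n /= ->]; first by case: w => x //=; rewrite addr0.
  by case: w => x //=; rewrite -addrA -natr1.
have iter2 n w : iter n shift2 w = sum_map id (fun x => x + n%:R) w.
  elim: n => [|n /= ->]; first by case: w => x //=; rewrite addr0.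
  by case: w => x //=; rewrite -addrA -natr1.
have p0 : p%:R = 0 :> 'F_p by rewrite pchar_Fp_0.
have it1 w : iter p shift1 w = w.
  by rewrite iter1 p0; case: w => x /=; rewrite ?addr0.
have it2 w : iter p shift2 w = w.
  by rewrite iter2 p0; case: w => x /=; rewrite ?addr0.
(* A map [f] whose p-th iterate is the identity is inverted by its iterate p - 1, so it transports
   along [h0] to a permutation of [V]. *)
have conj_perm f : (forall w, iter p f w = w) ->
    exists c : {perm V}, (c ^+ p)%g = 1%g /\ forall w, c (h0 w) = h0 (f w).
  move=> fp; have f_inj : injective f.
    apply: (can_inj (g := iter p.-1 f)) => w.
    by rewrite -iterSr prednK ?prime_gt0.
  have c_inj := inj_comp (can_inj h0K) (inj_comp f_inj (can_inj kK)).
  have cE w : perm c_inj (h0 w) = h0 (f w) by rewrite permE /= h0K.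
  have iter_c n w : iter n (perm c_inj) (h0 w) = h0 (iter n f w).
    by elim: n => //= n ->.
  exists (perm c_inj); split=> //; apply/permP => v.
  by rewrite -[v]kK permX perm1 iter_c fp.
have [[c [c_p cE]] [d [d_p dE]]] := (conj_perm _ it1, conj_perm _ it2).
have cd : commute c d.
  apply/permP => v; rewrite -[v]kK !permM cE !dE cE.
  by case: (k v).
(* [Aut_graph G] is declared as a mere set; the stabiliser supplies the group structure that Sylow's
   theorem needs. *)
have [|x [xc xd]] := conj_commuting_p_elts (A := 'C[edges G | ('P^* )^* ]%G)
  p_pr p_odd cardV _ c_p d_p cd.
  by move: pG; rewrite Aut_graphE.
move: xc xd; rewrite /= -!Aut_graphE !inE => /forallP cA /forallP dA.
(* Since [c ^ x] sends x (h0 w) to x (h0 (shift1 w)), and likewise for [d], relabelling by [x] turns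
   these two automorphisms into the shifts. *)
exists (x \o h0); split=> [|u v|u v].
- by apply: bij_comp; [exists x^-1%g; [apply: permK | apply: permKV] | exists k].
- by have /forallP/(_ (x (h0 v)))/eqP := cA (x (h0 u)); rewrite !permJ !cE.
- by have /forallP/(_ (x (h0 v)))/eqP := dA (x (h0 u)); rewrite !permJ !dE.
Qed.

Lemma union_or_join_of_shifts (V : finType) (G : sgraph V) (h : 'F_p + 'F_p -> V) :
  bijective h ->
  (forall u v, adj G (h (shift1 u)) (h (shift1 v)) = adj G (h u) (h v)) ->
  (forall u v, adj G (h (shift2 u)) (h (shift2 v)) = adj G (h u) (h v)) ->
  exists G1 G2 : sgraph 'I_p,
    [/\ edgeless_or_circulant p G1, edgeless_or_circulant p G2
      & giso G (gunion G1 G2) \/ giso G (gjoin G1 G2)].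
Proof.
move=> bij_h h1 h2.
(* The graphs sought live on ['I_p], the translations on ['F_p]; [b] relabels the vertices. *)
have [b bij_b] : exists b : 'I_p -> 'F_p, bijective b.
  by apply: eq_card_bij; rewrite card_Fp // card_ord.
have hl_inj : injective (h \o inl) := inj_comp (bij_inj bij_h) inl_inj.
have hr_inj : injective (h \o inr) := inj_comp (bij_inj bij_h) inr_inj.
have b_inj := bij_inj bij_b.
pose H1 : sgraph 'F_p := induced_graph (h \o inl) G.
pose H2 : sgraph 'F_p := induced_graph (h \o inr) G.
exists (induced_graph b H1), (induced_graph b H2); split.
- apply: edgeless_or_circulant_giso (giso_induced _ bij_b) _.
  by apply: shift_invariant_circulant => x y; rewrite !adj_induced //; apply: (h1 (inl x) (inl y)).
- apply: edgeless_or_circulant_giso (giso_induced _ bij_b) _.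
  by apply: shift_invariant_circulant => x y; rewrite !adj_induced //; apply: (h2 (inr x) (inr y)).
pose hb := h \o sum_map b b.
have bij_hb : bijective hb.
  have [b' bK b'K] := bij_b; apply: bij_comp bij_h _.
  by exists (sum_map b' b') => -[] x /=; rewrite ?bK ?b'K.
(* Each shift moves one half and fixes the other, so both endpoints can be brought to 0
   independently. *)
have cross x y : adj G (h (inl x)) (h (inr y)) = adj G (h (inl 0)) (h (inr 0)).
  rewrite (Fp_shift_const (F := fun x => adj G (h (inl x)) (h (inr y)))); last first.
    by move=> t; rewrite -[RHS]h1.
  rewrite (Fp_shift_const (F := fun y => adj G (h (inl 0)) (h (inr y)))) // => t.
  by rewrite -[RHS]h2.
have H1E (x y : 'I_p) :
    adj (induced_graph b H1) x y = adj G (h (inl (b x))) (h (inl (b y))).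
  by rewrite !adj_induced.
have H2E (x y : 'I_p) :
    adj (induced_graph b H2) x y = adj G (h (inr (b x))) (h (inr (b y))).
  by rewrite !adj_induced.
(* This single value decides whether all cross pairs are edges (join) or none is (union). *)
case G0: (adj G (h (inl 0)) (h (inr 0))); [right | left];
    apply: giso_sym; apply/gisoP; exists hb => // -[x|x] [y|y];
    rewrite ?adj_gjoin ?adj_gunion ?H1E ?H2E //=.
- by rewrite cross.
- by rewrite adj_sym cross.
- by rewrite cross.
- by rewrite adj_sym cross.
Qed.

End PrimeField.

Theorem lemma3p3 (p : nat) (V : finType) (G : sgraph V)
  (p_prime : prime p) (p_odd : odd p) (cardV : #|V| = 2 * p) :
  (p ^ 2 %| #|Aut_graph G| <-> ~~ (p %| #|iso_class G|)) /\
  (p ^ 2 %| #|Aut_graph G| ->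
   exists G1 G2 : sgraph 'I_p,
     [/\ edgeless_or_circulant p G1,
         edgeless_or_circulant p G2
       & giso G (gunion G1 G2) \/ giso G (gjoin G1 G2)]).
Proof.
split; last first.
  move=> pG; have [h [bij_h h1 h2]] := bi_shift_coordinates p_prime p_odd cardV pG.
  exact: union_or_join_of_shifts bij_h h1 h2.
have cardG := card_iso_class G; have := fact_gt0 #|V|.
rewrite -cardG muln_gt0 => /andP[cls_gt0 aut_gt0].
(* The two valuations sum to 2, so that of the automorphism group reaches 2 exactly when that of the
   class is 0. *)
have : logn p #|iso_class G| + logn p #|Aut_graph G| = 2.
  by rewrite -lognM // cardG cardV logn_fact_double.
rewrite pfactor_dvdn // -[p in p %| _]expn1 pfactor_dvdn // => log2.
by split; lia.
Qed.
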